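(* For all integers $S\geq 3$ and $T\geq 4$, the semigroup $\mathbb{N}A_{S,T}$ generated by the columns of the design matrix $A_{S,T}$ of the toric homogeneous Markov chain model (with initial parameters and with self-loops allowed) is not normal.
   Context: Let $[S]=\{1,\dots,S\}$ and let $[S]^T$ be the set of all words $w=(s_1,\dots,s_T)$ of length $T$ on $[S]$. The design matrix $A_{S,T}$ is the $(S+S^2)\times S^T$ matrix with rows indexed by the disjoint union $[S]\cup[S]^2$ and columns indexed by $[S]^T$: the entry in row $s\in[S]$ and column $w=(s_1,\dots,s_T)$ is $1$ if $s=s_1$ and $0$ otherwise; the entry in row $(i,j)\in[S]^2$ and column $w$ is the number of $t\in\{1,\dots,T-1\}$ with $(s_t,s_{t+1})=(i,j)$. For an integer matrix $A\in\mathbb{Z}^{d\times m}$ with columns $A_1,\dots,A_m$, let $\mathbb{N}A=\{n_1A_1+\cdots+n_mA_m\mid n_i\in\mathbb{N}\}$ with $\mathbb{N}=\{0,1,2,\dots\}$. The semigroup $\mathbb{N}A$ is called normal if: $x\in\mathbb{N}A$ if and only if there exist $y\in\mathbb{Z}^m$ and $\alpha\in\mathbb{R}^m_{\geq 0}$ with $x=Ay$ and $x=A\alpha$. *)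

(* Defs.v *)
From HB Require Import structures.
From mathcomp Require Import all_boot all_order all_algebra.
From mathcomp Require Import reals.

Set Implicit Arguments.
Unset Strict Implicit.
Unset Printing Implicit Defensive.

Import Order.TTheory GRing.Theory Num.Theory.
Local Open Scope ring_scope.

Definition in_semigroup (d m : nat) (A : 'M[int]_(d, m)) (x : 'cV[int]_d) : Prop :=
  exists n : 'I_m -> nat, x = \sum_(j < m) col j A *+ n j.

(* It is enough to let x range over integer vectors: x in NA and x = A y both
   force this. *)
Definition normal_semigroup (R : realType) (d m : nat) (A : 'M[int]_(d, m)) : Prop :=
  forall x : 'cV[int]_d,
    in_semigroup A x <->
    exists (y : 'cV[int]_m) (alpha : 'cV[R]_m),
      [/\ forall j, 0 <= alpha j 0,
          x = A *m y
        & map_mx intr x = map_mx intr A *m alpha].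

(* The letters 1, ..., S are represented by 'I_S, i.e. by 0, ..., S - 1. *)
Definition word (S T : nat) : finType := T.-tuple 'I_S.

Definition row_label (S : nat) : finType := ('I_S + 'I_S * 'I_S)%type.

(* zip w (behead w) lists the pairs (s_t, s_{t+1}) for 1 <= t <= T - 1. *)
Definition design_entry (S T : nat) (r : row_label S) (w : word S T) : nat :=
  match r with
  | inl s => ohead w == Some s
  | inr p => count_mem p (zip w (behead w))
  end.

Definition design_matrix (S T : nat) : 'M[int]_(#|row_label S|, #|word S T|) :=
  \matrix_(r, w) (design_entry (enum_val r) (enum_val w))%:Z.

(* Main.v *)
Require Import Defs.
From mathcomp Require Import all_boot all_order all_algebra.
From mathcomp Require Import reals.
From mathcomp Require Import ring zify.

Set Implicit Arguments.
Unset Strict Implicit.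
Unset Printing Implicit Defensive.

Import GRing.Theory Num.Theory.

(** Take three letters [a], [b], [c] and write [T = n + 4].  The vector [hole],
which prescribes two words starting at [a] with the transitions [ab] twice, [ac]
and [ba] once, and [bb] and [cc] each [n + 1 = T - 3] times, lies in the cone and
in the lattice of the columns but not in the semigroup.

It lies in the cone because its double is the sum of the columns of
[a b^(T-1)], [a c^(T-1)], [a b a c^(T-3)] and [a b a b^(T-3)]
([hole_in_cone]).  It lies in the lattice because the first and the third of
these words together differ from it only by one [bb] too many and one [cc] too
few, which is corrected by adding [b c^(T-1)] and subtracting [b b c^(T-2)]
([hole_in_lattice]).

It is not in the semigroup ([hole_not_sum]).  A sum of columns equal to it only
involves words that start at [a] and use the transitions above, so that [c] can
be entered only by [ac] and is never left.  As [ac] occurs once in all, a single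
word visits [c], and this word carries all [T - 3] transitions [cc].  But if it
enters [c] at its first step, it has [T - 2] of them; otherwise it starts with
[ab], needs at least one more step to return to [a] and one to enter [c], and has
at most [T - 4].  The value [T - 3] is skipped ([count_cc_gap]). *)

(** * Transitions of a word *)

Section Transitions.
Variable L : eqType.
Implicit Types s : seq L.

Definition transitions s := zip s (behead s).
Arguments transitions : simpl never.

Lemma transitions_cons2 (x y : L) s :
  transitions [:: x, y & s] = (x, y) :: transitions (y :: s).
Proof. by []. Qed.

Lemma count_transitions_cons2 p (x y : L) s :
  count p (transitions [:: x, y & s]) =
  p (x, y) + count p (transitions (y :: s)).
Proof. by []. Qed.

Lemma transitions_constant (x : L) n :
  transitions (x :: nseq n x) = nseq n (x, x).
Proof. by elim: n => //= n IHn; rewrite -IHn. Qed.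

Variables (a b c : L) (n : nat).
Definition hole_transitions : seq (L * L) :=
  [:: (a, b); (a, b); (a, c); (b, a)] ++ nseq n.+1 (b, b) ++ nseq n.+1 (c, c).

Hypothesis abc : uniq [:: a; b; c].

Lemma mem_hole_transitions p :
  (p \in hole_transitions) =
  (p \in [:: (a, b); (a, c); (b, a); (b, b); (c, c)]).
Proof.
rewrite !(inE, mem_cat, mem_nseq) /=.
case: (0 < n); case: (p == (a, b)); case: (p == (a, c));
by case: (p == (b, a)); case: (p == (b, b)); case: (p == (c, c)).
Qed.

Lemma neq_abc : ((a == b = false) * (a == c = false) * (b == c = false)) *
              ((b == a = false) * (c == a = false) * (c == b = false)).
Proof.
rewrite !(eq_sym _ a) (eq_sym c).
move: abc; rewrite /= !inE negb_or.
by case/and3P=> /andP[/negPf-> /negPf->] /negPf->.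
Qed.

Lemma hole_step_from_a y : (a, y) \in hole_transitions -> y = b \/ y = c.
Proof.
rewrite mem_hole_transitions !inE !xpair_eqE !neq_abc eqxx /= orbF.
by case/orP => /eqP; [left | right].
Qed.

Lemma hole_step_from_c y : (c, y) \in hole_transitions -> y = c.
Proof.
by rewrite mem_hole_transitions !inE !xpair_eqE !neq_abc eqxx /= => /eqP.
Qed.

Lemma hole_step_to_c x : (x, c) \in hole_transitions -> x = a \/ x = c.
Proof.
rewrite mem_hole_transitions !inE !xpair_eqE !neq_abc eqxx !andbF !andbT /=.
by case/orP => /eqP; [left | right].
Qed.

Lemma subset_transitions_cons x y s :
  {subset transitions [:: x, y & s] <= hole_transitions} ->
  (x, y) \in hole_transitions /\
  {subset transitions (y :: s) <= hole_transitions}.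
Proof.
rewrite transitions_cons2 => sub; split=> [|p ps]; apply: sub.
  exact: mem_head.
by rewrite inE ps orbT.
Qed.

(** Without [ac] the walk is confined to [{a, b}]; the statement allows either
starting letter so that induction along the walk goes through. *)
Lemma count_cc_eq0 x s : x != c ->
  {subset transitions (x :: s) <= hole_transitions} ->
  (a, c) \notin transitions (x :: s) ->
  count_mem (c, c) (transitions (x :: s)) = 0.
Proof.
elim: s x => //= y s IHs x xc /subset_transitions_cons[xy sub].
rewrite transitions_cons2 inE negb_or => /andP[acxy acs].
rewrite /= xpair_eqE (negPf xc) /= IHs //.
apply: contraNneq acxy => yc; rewrite {}yc in xy *.
by case: (hole_step_to_c xy) xc => ->; rewrite eqxx.
Qed.

Lemma transitions_from_c s :
  {subset transitions (c :: s) <= hole_transitions} ->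
  transitions (c :: s) = nseq (size s) (c, c).
Proof.
elim: s => //= y s IHs /subset_transitions_cons[/hole_step_from_c-> sub].
by rewrite transitions_cons2 IHs.
Qed.

(** There is no transition [aa], so a word cannot postpone its entrance into [c]
by exactly one step. *)
Lemma count_cc_gap s : size s = n.+3 ->
  {subset transitions (a :: s) <= hole_transitions} ->
  count_mem (c, c) (transitions (a :: s)) != n.+1.
Proof.
case: s => [|y [|z [|t s]]] // [sz] /subset_transitions_cons[ay sub].
rewrite count_transitions_cons2 [pred1 _ _]/= xpair_eqE !neq_abc add0n.
case: (hole_step_from_a ay) sub => -> sub.
  have [bz _] := subset_transitions_cons sub.
  have zc : z != c.
    apply: contraTneq bz => ->; apply/negP => /hole_step_to_c.
    by case=> /eqP; rewrite neq_abc.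
  rewrite /= !xpair_eqE neq_abc (negPf zc) /= neq_ltn ltnS.
  by rewrite (leq_trans (count_size _ _)) // size_zip /= sz; lia.
by rewrite transitions_from_c // count_nseq /= eqxx sz; lia.
Qed.

End Transitions.
Arguments transitions {L} s : simpl never.

(** * Rational and integral combinations of columns *)

(** Rational coefficients with a common denominator [k] suffice to put [x] in the
real cone. *)
Lemma normal_semigroup_divisible (R : realType) d m (A : 'M[int]_(d, m))
    (x : 'cV[int]_d) (y z : 'cV[int]_m) k :
  normal_semigroup R A -> (0 < k)%N -> x = (A *m y)%R ->
  (forall j, (0 <= z j 0)%R) -> (x *+ k = A *m z)%R -> in_semigroup A x.
Proof.
move=> nA k0 xy z0 xz; apply/nA.
exists y, ((k%:R : R)^-1 *: map_mx intr z)%R; split=> // [j|].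
  by rewrite !mxE mulr_ge0 ?invr_ge0 ?ler0n ?ler0z.
have k_neq0 : (k%:R : R)%R != 0%R by rewrite pnatr_eq0 -lt0n.
rewrite -scalemxAr -map_mxM -xz.
apply/matrixP => i j; rewrite mxE [in RHS]mxE mxE mulmxnE rmorphMn /=.
by rewrite -[X in (_ * X)%R]mulr_natl mulKf.
Qed.

Section Design.
Variables S T : nat.
Local Notation A := (design_matrix S T).
Local Notation word := (word S T).

Definition column (w : word) : 'cV[int]_#|row_label S| :=
  \col_r (design_entry (enum_val r) w)%:Z%R.

Definition unit_of (w : word) : 'cV[int]_#|word| := delta_mx (enum_rank w) 0%R.

Lemma design_mul_unit w : (A *m unit_of w)%R = column w.
Proof. by rewrite -colE; apply/matrixP => i j; rewrite !mxE enum_rankK. Qed.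

Lemma unit_of_ge0 w j : (0 <= unit_of w j 0)%R.
Proof. by rewrite mxE ler0n. Qed.

Lemma in_semigroup_design (h : row_label S -> nat) :
  in_semigroup A (\col_r (h (enum_val r))%:Z)%R ->
  exists N : word -> nat, forall r, h r = \sum_w N w * design_entry r w.
Proof.
case=> N xN; exists (fun w => N (enum_rank w)) => r.
have /(congr1 (fun v : 'cV[int]_#|row_label S| => v (enum_rank r) 0%R)) := xN.
rewrite !mxE enum_rankK summxE => hr; apply/eqP.
rewrite -eqz_nat hr -[X in _ == X]natz natr_sum.
rewrite [X in _ == X](reindex (@enum_val word xpredT)) /=; last first.
  by exists enum_rank => w _; [exact: enum_valK | exact: enum_rankK].
apply/eqP/eq_bigr => j _.
by rewrite mulmxnE !mxE enum_rankK enum_valK natrM mulr_natl natz.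
Qed.

End Design.

(** * The hole *)

Definition hole S (a b c : 'I_S) n (r : row_label S) : nat :=
  match r with
  | inl s => 2 * (a == s)
  | inr p => count_mem p (hole_transitions a b c n)
  end.

Section Hole.
Variables (S n : nat) (a b c : 'I_S).
Local Notation word := (word S n.+4).

Definition word_a_b : word := [tuple of [:: a, b, b, b & nseq n b]].
Definition word_a_c : word := [tuple of [:: a, c, c, c & nseq n c]].
Definition word_aba_c : word := [tuple of [:: a, b, a, c & nseq n c]].
Definition word_aba_b : word := [tuple of [:: a, b, a, b & nseq n b]].
Definition word_b_c : word := [tuple of [:: b, c, c, c & nseq n c]].
Definition word_bb_c : word := [tuple of [:: b, b, c, c & nseq n c]].

(** Halving the four words is harmless for [ab], [ac] and [ba], which they use an
even number of times in total, while the words with an early and a late entrance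
into [c] average to the forbidden number of [cc]. *)
Lemma hole_in_cone r :
  2 * hole a b c n r =
    design_entry r word_a_b + design_entry r word_a_c
    + design_entry r word_aba_c + design_entry r word_aba_b.
Proof.
case: r => [s|p] /=; first by rewrite -[Some a == _]/(a == s); ring.
rewrite -!/(transitions (_ :: nseq n _)) !transitions_constant.
by rewrite !count_cat /= !count_nseq /=; ring.
Qed.

(** The words [b c^(T-1)] and [b b c^(T-2)] trade one [cc] for one [bb]; their
initial letters and their single [bc] cancel. *)
Lemma hole_in_lattice r :
  hole a b c n r + design_entry r word_bb_c =
    design_entry r word_a_b + design_entry r word_aba_c
    + design_entry r word_b_c.
Proof.
case: r => [s|p] /=; first by rewrite -[Some a == _]/(a == s); ring.
rewrite -!/(transitions (_ :: nseq n _)) !transitions_constant.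
by rewrite !count_cat /= !count_nseq /=; ring.
Qed.

Lemma normal_hole_in_semigroup (R : realType) :
  normal_semigroup R (design_matrix S n.+4) ->
  exists N : word -> nat,
    forall r, hole a b c n r = \sum_w N w * design_entry r w.
Proof.
move=> nA; apply: in_semigroup_design.
pose y := (unit_of word_a_b + unit_of word_aba_c + unit_of word_b_c
           - unit_of word_bb_c)%R.
pose z := (unit_of word_a_b + unit_of word_a_c + unit_of word_aba_c
           + unit_of word_aba_b)%R.
apply: (normal_semigroup_divisible (y := y) (z := z) (k := 2) nA) => // [|j|].
- rewrite mulmxBr !mulmxDr !design_mul_unit; apply/matrixP => i j; rewrite !mxE.
  by apply/eqP; rewrite eq_sym subr_eq -!PoszD eqz_nat hole_in_lattice.
- by rewrite 3!mxE !addr_ge0 ?unit_of_ge0.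
- rewrite !mulmxDr !design_mul_unit; apply/matrixP => i j.
  by rewrite mulmxnE !mxE -!PoszD -hole_in_cone PoszM -mulr_natl natz.
Qed.

(** All [cc] must come from the one word that uses [ac], and that word cannot carry
exactly [n + 1] of them. *)
Lemma hole_not_sum (N : word -> nat) : uniq [:: a; b; c] ->
  ~ (forall r, hole a b c n r = \sum_w N w * design_entry r w).
Proof.
move=> abc hN.
have used_row r w : 0 < N w -> 0 < design_entry r w -> 0 < hole a b c n r.
  by rewrite hN (bigD1 w) //= => Nw ew; rewrite ltn_addr // muln_gt0 Nw.
have used_word w : 0 < N w -> exists s, [/\ tval w = a :: s, size s = n.+3
    & {subset transitions (a :: s) <= hole_transitions a b c n}].
  move=> Nw; have := fun r => used_row r w Nw.
  case: w {Nw} => -[|x s] //= sz used.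
  have xa : x = a.
    by have := used (inl x); rewrite /= eqxx => /(_ isT); case: eqP.
  subst x.
  exists s; split=> // [|p ps]; first by case: (eqP sz).
  have := used (inr p); rewrite /design_entry /hole -!has_count !has_pred1.
  by apply.
have ac_once : \sum_w N w * design_entry (inr (a, c)) w = 1.
  rewrite -hN /hole !count_cat !count_nseq /= !xpair_eqE !(neq_abc abc).
  by rewrite !eqxx.
have cc_total : \sum_w N w * design_entry (inr (c, c)) w = n.+1.
  rewrite -hN /hole !count_cat !count_nseq /= !xpair_eqE !(neq_abc abc).
  by rewrite !eqxx mul1n.
(* A sum of naturals equal to 1 has a single nonzero term. *)
have /existsP[w ac_w] : [exists w, 0 < N w * design_entry (inr (a, c)) w].
  apply: contra_eqT ac_once => /existsPn ac0.
  by rewrite big1 // => w _; apply/eqP; rewrite -leqn0 leqNgt.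
move: ac_once; rewrite (bigD1 w isT).
set e := (N w * _)%N in ac_w *; set rest := \sum_(v | _) _ => ac_once.
have {ac_w ac_once} [e1 rest0] : e = 1 /\ rest = 0.
  by case: e rest ac_w ac_once => [|[|e]] [|rest].
have Nw1 : N w = 1 by move/eqP: e1; rewrite muln_eq1 => /andP[/eqP].
have [|s [ws sz sub]] := used_word w; first by rewrite Nw1.
(* All other words avoid [ac], so [w] alone accounts for [cc_total]. *)
have /eqP[] := count_cc_gap abc sz sub.
rewrite -cc_total (bigD1 w) //= Nw1 mul1n big1 ?addn0 => [|v vw].
  by rewrite ws.
have [->//|Nv] := posnP (N v).
have [u [vu _ subu]] := used_word v Nv.
have /eqP := rest0; rewrite sum_nat_eq0 => /forallP/(_ v)/implyP/(_ vw).
rewrite muln_eq0 gtn_eqF //= vu -/(transitions _) -leqn0 leqNgt.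
rewrite -has_count has_pred1 => acu.
by rewrite (count_cc_eq0 abc _ subu acu) ?muln0 ?(neq_abc abc).
Qed.

End Hole.

Theorem lemma4p1 (R : realType) (S T : nat) (hS : (3 <= S)%N) (hT : (4 <= T)%N) :
  ~ normal_semigroup R (design_matrix S T).
Proof.
case: S hS => [|[|[|S]]] // _; case: T hT => [|[|[|[|n]]]] // _ nA.
pose b : 'I_S.+3 := inord 1; pose c : 'I_S.+3 := inord 2.
have [N hN] := normal_hole_in_semigroup ord0 b c nA.
apply: (hole_not_sum _ hN).
by rewrite /= !inE -!val_eqE /= !inordK.
Qed.
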